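(* Let $X$ be a complete metric space, $k\ge 2$, and let $\mathcal{F}=\{f_1,\dots,f_k\}$ be a finite family of similitudes of $X$ with similarity ratios $c_1,\dots,c_k\in(0,1)$. Let $\mathcal{K}$ be the attractor of $\mathcal{F}$, $\alpha$ its similarity dimension, and $\mathbf{\Gamma}$ the natural fractal structure on $\mathcal{K}$. The following statements are equivalent: (i) $\mathbf{\Gamma}$ is irreducible. (ii) $\dim_{\mathbf{\Gamma}}^{4}(\mathcal{K})=\dim_{\mathbf{\Gamma}}^{3}(\mathcal{K})=\alpha$. (iii) $\mathcal{F}$ satisfies the level separation property LSP. (iv) $\mathcal{F}$ satisfies LSP2, and for all finite words $\mathbf{i},\mathbf{j}$ over $\Sigma=\{1,\dots,k\}$, $A_{\mathbf{i}}\subseteq A_{\mathbf{j}}$ implies $\mathbf{j}\sqsubseteq\mathbf{i}$. (v) $\mathbf{\Gamma}$ is a tiling. (vi) $\mathcal{H}_4^{\alpha}(\mathcal{K})>0$.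
   Context: A similitude of $(X,\rho)$ with ratio $c_i\in(0,1)$ is a map $f_i:X\to X$ with $\rho(f_i(x),f_i(y))=c_i\,\rho(x,y)$ for all $x,y$. The attractor $\mathcal{K}\subseteq X$ is the unique nonempty compact set with $\mathcal{K}=\bigcup_{i=1}^k f_i(\mathcal{K})$. The similarity dimension $\alpha>0$ is the unique solution of $\sum_{i=1}^k c_i^{\alpha}=1$. Let $\Sigma=\{1,\dots,k\}$; for $\mathbf{i}=i_1\cdots i_n\in\Sigma^n$ put $f_{\mathbf{i}}=f_{i_1}\circ\cdots\circ f_{i_n}$ and $A_{\mathbf{i}}=f_{\mathbf{i}}(\mathcal{K})$. Write $\mathbf{j}\sqsubseteq\mathbf{i}$ if $\mathbf{j}$ is a prefix of $\mathbf{i}$. The natural fractal structure on $\mathcal{K}$ is $\mathbf{\Gamma}=\{\Gamma_n\}_{n\in\mathbb{N}}$ ($n\ge1$) with $\Gamma_n=\{A_{\mathbf{i}}:\mathbf{i}\in\Sigma^n\}$. A set may appear more than once in a level, so $\Gamma_n$ is regarded as a family indexed by $\Sigma^n$, and two elements $A_{\mathbf{i}},A_{\mathbf{j}}$ of $\Gamma_n$ are different elements when $\mathbf{i}\ne\mathbf{j}$. All interiors and closures below are taken in $\mathcal{K}$. $\mathbf{\Gamma}$ is irreducible if for each $n$ the covering $\Gamma_n$ of $\mathcal{K}$ has no proper subcovering (for every $\mathbf{i}\in\Sigma^n$, $\bigcup_{\mathbf{j}\in\Sigma^n,\,\mathbf{j}\neq\mathbf{i}}A_{\mathbf{j}}\ne\mathcal{K}$).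 LSP1: for every $n$, different elements of $\Gamma_n$ have disjoint interiors. LSP2: for every $n$, each element of $\Gamma_n$ has nonempty interior. LSP: both LSP1 and LSP2 hold. $\mathbf{\Gamma}$ is a tiling if for every $n$ different elements of $\Gamma_n$ have disjoint interiors and each $A\in\Gamma_n$ is regularly closed, i.e. $\overline{A^{\circ}}=A$. For $s\ge0$, $n\ge1$ let $\mathcal{H}_{n,3}^s(\mathcal{K})=\inf\{\sum_{\mathbf{i}\in\Sigma^l}\mathrm{diam}(A_{\mathbf{i}})^s: l\ge n\}$, and let $\mathcal{H}_{n,4}^s(\mathcal{K})=\inf\sum_{i\in I}\mathrm{diam}(B_i)^s$, the infimum over all finite families $\{B_i\}_{i\in I}$ with $B_i\in\bigcup_{l\ge n}\Gamma_l$ and $\mathcal{K}\subseteq\bigcup_{i\in I}B_i$. For $m=3,4$ let $\mathcal{H}_m^s(\mathcal{K})=\lim_{n\to\infty}\mathcal{H}_{n,m}^s(\mathcal{K})$ and define the fractal dimensions III ($m=3$) and IV ($m=4$) by $\dim_{\mathbf{\Gamma}}^m(\mathcal{K})=\inf\{s\ge0:\mathcal{H}_m^s(\mathcal{K})=0\}=\sup\{s\ge0:\mathcal{H}_m^s(\mathcal{K})=\infty\}$ (with $\sup\emptyset=0$). *)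

(* Defs.v *)
From HB Require Import structures.
From mathcomp Require Import all_boot all_order all_algebra.
From mathcomp Require Import all_classical all_reals all_analysis.

Set Implicit Arguments.
Unset Strict Implicit.
Unset Printing Implicit Defensive.

Import Order.TTheory GRing.Theory Num.Theory.

Local Open Scope classical_set_scope.
Local Open Scope ring_scope.

#[short(type="completeMetricType")]
HB.structure Definition CompleteMetric (R : numDomainType) :=
  { X of Complete X & Metric R X }.

(* Extended-real valued; on the empty set this is -oo, but it is only ever
   applied to nonempty sets below. *)
Definition diam (R : realType) (X : metricType R) (A : set X) : \bar R :=
  ereal_sup [set (mdist x y)%:E | x in A & y in A].

(* The topology of [subspace K] isolates the points outside K, so for A
   included in K these are the interior and the closure of A relative to K. *)
Definition interior_in (X : topologicalType) (K A : set X) : set X :=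
  @interior (subspace K) A.
Definition closure_in (X : topologicalType) (K A : set X) : set X :=
  @closure (subspace K) A.

Section IteratedFunctionSystem.
Context {R : realType} {X : metricType R} {k : nat}.

Definition similitude (g : X -> X) (c : R) : Prop :=
  forall x y, mdist (g x) (g y) = c * mdist x y.

Variable f : 'I_k -> X -> X.

Definition is_attractor (K : set X) : Prop :=
  [/\ K !=set0, compact K & K = \bigcup_(i in [set: 'I_k]) (f i @` K)].

Definition is_similarity_dim (c : 'I_k -> R) (alpha : R) : Prop :=
  0 < alpha /\ \sum_(i < k) c i `^ alpha = 1.

(* f_(i1 ... in) = f_i1 \o ... \o f_in *)
Definition word_map (w : seq 'I_k) : X -> X :=
  foldr (fun i g => f i \o g) id w.

Variable K : set X.

Definition piece (w : seq 'I_k) : set X := word_map w @` K.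

(* The n-th level of the natural fractal structure, as an indexed family:
   different indices count as different elements even if the sets agree. *)
Definition level (n : nat) (w : n.-tuple 'I_k) : set X := piece w.

Definition irreducible : Prop :=
  forall n, (1 <= n)%N -> forall w : n.-tuple 'I_k,
    \bigcup_(v in [set v : n.-tuple 'I_k | v <> w]) level v <> K.

Definition LSP1 : Prop :=
  forall n, (1 <= n)%N -> forall v w : n.-tuple 'I_k, v <> w ->
    interior_in K (level v) `&` interior_in K (level w) = set0.

Definition LSP2 : Prop :=
  forall n, (1 <= n)%N -> forall w : n.-tuple 'I_k,
    interior_in K (level w) !=set0.

Definition LSP : Prop := LSP1 /\ LSP2.

Definition tiling : Prop :=
  forall n, (1 <= n)%N ->
    (forall v w : n.-tuple 'I_k, v <> w ->
       interior_in K (level v) `&` interior_in K (level w) = set0) /\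
    (forall w : n.-tuple 'I_k,
       closure_in K (interior_in K (level w)) = level w).

Local Open Scope ereal_scope.

Definition Hn3 (n : nat) (s : R) : \bar R :=
  ereal_inf [set \sum_(w : l.-tuple 'I_k) diam (level w) `^ s
            | l in [set l | (n <= l)%N]].

Definition Hn4 (n : nat) (s : R) : \bar R :=
  ereal_inf [set x | exists m (B : 'I_m -> set X),
    [/\ forall i, exists2 l, (n <= l)%N &
          exists w : l.-tuple 'I_k, B i = level w,
        K `<=` \bigcup_(i in [set: 'I_m]) B i &
        x = \sum_(i < m) diam (B i) `^ s]].

Definition H3 (s : R) : \bar R := limn (fun n => Hn3 n s).
Definition H4 (s : R) : \bar R := limn (fun n => Hn4 n s).

Definition critical_exponent (H : R -> \bar R) : \bar R :=
  ereal_inf [set s%:E | s in [set s | (0 <= s)%R /\ H s = 0]].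

Definition dim3 : \bar R := critical_exponent H3.
Definition dim4 : \bar R := critical_exponent H4.

End IteratedFunctionSystem.

(* Main.v *)
(** Irreducibility means that for every word w some "private" point of K lies
    in no piece of the level of w other than A_w.  Given private points, any
    finite cover of K by pieces A_(w_i) is such that every sufficiently long
    word extends one of the w_i, whence sum_i c_(w_i)^alpha >= 1 as in Kraft's
    inequality: H_4^alpha is at least (diam K)^alpha > 0, and both dimensions
    equal alpha.  If instead w has no private point, then K is also the
    attractor of the maps f_v, |v| = |w|, v <> w, whose powers c_v^s sum to
    less than 1 for s = alpha, hence also for some s < alpha, and iterating
    these maps gives H_4^s = 0.

    The separation properties are linked to private points by two facts: a
    nonempty interior meeting A_w contains a whole piece A_(wt), as pieces
    shrink; and a nonempty relatively open set covered by finitely many pieces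
    meets the interior of one of them. *)

Require Import Defs.
From HB Require Import structures.
From mathcomp Require Import all_boot all_order all_algebra.
From mathcomp Require Import all_classical all_reals all_analysis.
From mathcomp Require Import zify lra.
Import Order.TTheory GRing.Theory Num.Theory.
Import numFieldNormedType.Exports.
Local Open Scope classical_set_scope.
Local Open Scope ring_scope.
Set Implicit Arguments.
Unset Strict Implicit.

(** * Sums of multiplicative weights over words *)

Lemma big_tupleS (V : Type) (idx : V) (op : Monoid.com_law idx)
    (T : finType) n (F : n.+1.-tuple T -> V) :
  \big[op/idx]_(v : n.+1.-tuple T) F v =
  \big[op/idx]_(i : T) \big[op/idx]_(t : n.-tuple T) F (cons_tuple i t).
Proof.
rewrite pair_bigA /=.
rewrite (reindex (fun x : T * n.-tuple T => cons_tuple x.1 x.2)) //=.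
exists (fun v => (thead v, [tuple of behead v])) => [[i t] _|v _] /=.
  by congr pair; apply/val_inj.
by rewrite [RHS](tuple_eta v); apply/val_inj.
Qed.

(** This is the counting behind Kraft's inequality: when the weights [p i] sum to 1, the words of
    length [n] extending [w] together weigh as much as [w]. With [w] empty it evaluates the sum over
    a whole level. *)
Lemma sum_prefix_tuples (S : comPzSemiRingType) (T : finType) (p : T -> S)
    (w : seq T) (n : nat) : (size w <= n)%N ->
  \sum_(v : n.-tuple T | seq.prefix w v) \prod_(i <- v) p i =
  \prod_(i <- w) p i * (\sum_i p i) ^+ (n - size w).
Proof.
elim: n w => [|n IH] w; rewrite big_mkcond /=.
  case: w => // _; rewrite (big_pred1 (nil_tuple T)) => [|v].
    by rewrite /= !big_nil mul1r expr0.
  by apply/esym/eqP; rewrite [LHS]tuple0 [RHS]tuple0.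
rewrite big_tupleS; case: w => [|j w] /=.
  move=> _; rewrite big_nil mul1r exprS big_distrl /=; apply: eq_bigr => i _.
  have := IH [::] isT; rewrite big_nil mul1r subn0 => <-.
  rewrite [in RHS](eq_bigl xpredT) => [|t]; last exact: prefix0s.
  by rewrite big_distrr /=; apply: eq_bigr => t _; rewrite big_cons.
rewrite ltnS subSS => wn; rewrite (bigD1 j)//= [X in _ + X]big1 => [|i /negPf ij].
  rewrite addr0 big_cons -mulrA -IH// [in RHS]big_mkcond big_distrr /=.
  apply: eq_bigr => t _; rewrite eqxx /=.
  by case: ifP; rewrite ?mulr0// big_cons.
by rewrite big1// => t _; rewrite eq_sym ij.
Qed.

(** * Auxiliary facts from analysis and topology *)

Lemma geometric_lt (R : realType) (a q e : R) (N : nat) :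
  0 <= q < 1 -> 0 < e -> exists2 m, (N <= m)%N & a * q ^+ m < e.
Proof.
move=> /andP[q0 q1] e0.
have qn : `|q| < 1 by rewrite ger0_norm.
have : \forall m \near \oo, geometric a q m < e.
  exact: (cvgr_lt _ (cvg_geometric a qn)).
move=> [M _ hM]; exists (maxn N M); first exact: leq_maxl.
by apply: hM => /=; apply: leq_maxr.
Qed.

(** Either [F i] contains the trace of [V] on [K], or [V] minus [F i] is open, still meets [K] and
    has its trace covered by the remaining sets, so induction on [s] applies. *)
Lemma finite_baire (X : topologicalType) (I : eqType) (s : seq I)
    (F : I -> set X) (K V : set X) :
  (forall i, i \in s -> closed (F i)) -> open V -> V `&` K !=set0 ->
  (forall x, V x -> K x -> exists2 i, i \in s & F i x) ->
  exists2 i, i \in s &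
    exists W, [/\ open W, W `<=` V, W `&` K !=set0 & W `&` K `<=` F i].
Proof.
elim: s V => [|i s IH] V cF oV [x [Vx Kx]] cov; first by have [] := cov x Vx Kx.
have [sub|] := pselect (V `&` K `<=` F i).
  by exists i; [rewrite mem_head|exists V; split=> //; exists x].
move=> /existsNP[y /not_implyP[[Vy Ky] Fy]].
have [|||z [Vz Fz] Kz|j js [W [oW WV WK WF]]] := IH (V `\` F i).
- by move=> j js; apply: cF; rewrite inE js orbT.
- by rewrite setDE; apply: openI => //; apply: closed_openC; apply: cF; rewrite mem_head.
- by exists y.
- by have [j] := cov z Vz Kz; rewrite inE => /orP[/eqP-> //|js Fj]; exists j.
exists j; first by rewrite inE js orbT.
by exists W; split=> // z /WV[].
Qed.

Lemma interior_inP (X : topologicalType) (K A : set X) (x : X) : K x ->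
  interior_in K A x <-> exists V, [/\ open V, V x & V `&` K `<=` A].
Proof.
move=> Kx; rewrite /interior_in /interior /= (nbhs_subspace_ex _ Kx); split.
  move=> [V]; rewrite nbhsE => -[W [oW Wx] WV] AV; exists W; split=> //.
  by move=> y [/WV Vy Ky]; have : (V `&` K) y by []; rewrite -AV => -[].
(* A relative neighbourhood must have the same trace on [K] as an ambient one; adding [A] to [V]
   makes the two traces equal. *)
move=> [V [oV Vx VA]]; exists (V `|` A); last first.
  apply/seteqP; split=> y [] => [Ay Ky|[] Vy Ky]; split=> //; first by right.
  exact: VA.
by apply: filterS (open_nbhs_nbhs (conj oV Vx)) => y; left.
Qed.

Lemma nondecreasing_le_limn (R : realType) (u : (\bar R)^nat) (n : nat) :
  nondecreasing_seq u -> (u n <= limn u)%E.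
Proof.
move=> nd; rewrite (cvg_lim _ (ereal_nondecreasing_cvgn nd))//.
by apply: ereal_sup_ubound; exists n.
Qed.

Lemma critical_exponentE (R : realType) (H : R -> \bar R) (a : R) : 0 <= a ->
  (forall s, 0 <= s < a -> H s <> 0%E) -> (forall s, a < s -> H s = 0%E) ->
  critical_exponent H = a%:E.
Proof.
move=> a0 ltH gtH; apply/eqP; rewrite eq_le; apply/andP; split.
  apply/lee_addgt0Pr => e e0; rewrite -EFinD; apply: ereal_inf_lbound.
  exists (a + e) => //; split; first by rewrite addr_ge0// ltW.
  by apply: gtH; rewrite ltrDl.
apply/ereal_infP => _ [s [s0 Hs] <-]; rewrite lee_fin leNgt.
by apply/negP => sa; apply: ltH Hs; rewrite s0.
Qed.

Lemma continuous_powR (R : realType) (a : R) : 0 < a -> continuous (powR a).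
Proof.
move=> a0 s; rewrite /powR gt_eqF//.
have : {for s, continuous (expR \o (fun t => t * ln a))}.
  by apply: continuous_comp; [exact: mulrr_continuous|exact: continuous_expR].
exact.
Qed.
Lemma lipschitz1_continuous (R : realType) (X Y : metricType R) (g : X -> Y) :
  (forall x y, mdist (g x) (g y) <= mdist x y) -> continuous g.
Proof.
move=> gL x B; rewrite /nbhs_simpl /= => /nbhs_ballP[e e0 sub].
apply/nbhs_ballP; exists e => // y; rewrite ballEmdist /= => xy.
by apply: sub; rewrite ballEmdist /=; apply: le_lt_trans xy.
Qed.

Lemma compact_mdist_bound (R : realType) (X : metricType R) (K : set X) :
  K !=set0 -> compact K ->
  exists2 D, 0 <= D & forall x y, K x -> K y -> mdist x y <= D.
Proof.
move=> [x0 Kx0] cK.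
have dx0 : continuous (mdist x0 : X -> R).
  move=> x; apply/cvgrPdist_lt => e e0; apply/nbhs_ballP; exists e => // y.
  rewrite ballEmdist /=; apply: le_lt_trans.
  have := metric_triangle x0 x y; have := metric_triangle x0 y x.
  rewrite (metric_sym y) ler_norml; lra.
have [z _ zmax] := compact_EVT_max (ex_intro _ x0 Kx0) cK (continuous_subspaceT dx0).
exists (mdist x0 z + mdist x0 z); first by rewrite addr_ge0 ?mdist_ge0.
move=> x y Kx Ky; apply: le_trans (metric_triangle x x0 y) _.
by rewrite (metric_sym x) lerD ?zmax ?inE.
Qed.

(** * Pieces of the attractor and their diameters *)

Section IteratedFunctionSystem.
Context {R : realType} {X : metricType R} {k : nat}.
Variables (f : 'I_k -> X -> X) (c : 'I_k -> R) (K : set X).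
Hypothesis c01 : forall i, 0 < c i < 1.
Hypothesis f_sim : forall i, similitude (f i) (c i).
Hypothesis K_attractor : is_attractor f K.

Implicit Types u v w : seq 'I_k.

Local Notation ratio w := (\prod_(i <- w) c i).

Lemma ratio_gt0 w : 0 < ratio w.
Proof. by apply: prodr_gt0 => i _; case/andP: (c01 i). Qed.

Lemma ratio_le1 w : ratio w <= 1.
Proof.
by apply: prodr_ile1 => i _; case/andP: (c01 i) => /ltW-> /ltW->.
Qed.

Lemma word_map_cat u v : word_map f (u ++ v) = word_map f u \o word_map f v.
Proof. by elim: u => //= i u ->. Qed.

Lemma word_map_sim w : similitude (word_map f w) (ratio w).
Proof.
elim: w => [|i w IH] x y /=; first by rewrite big_nil mul1r.
by rewrite f_sim IH big_cons mulrA.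
Qed.

Lemma word_map_continuous w : continuous (word_map f w).
Proof.
apply: lipschitz1_continuous => x y.
by rewrite word_map_sim ler_piMl ?mdist_ge0 ?ratio_le1.
Qed.

Lemma piece_closed w : closed (piece f K w).
Proof.
have [_ cK _] := K_attractor; apply: compact_closed; first exact: metric_hausdorff.
apply: continuous_compact => //; apply: continuous_subspaceT.
exact: word_map_continuous.
Qed.

Lemma piece_sub w : piece f K w `<=` K.
Proof.
elim: w => [|i w IH] _ [x Kx <-] //=.
have [_ _ ->] := K_attractor; exists i => //=.
by exists (word_map f w x) => //; apply: IH; exists x.
Qed.

Lemma piece_catl u v : piece f K (u ++ v) `<=` piece f K u.
Proof.
move=> _ [x Kx <-]; rewrite word_map_cat; exists (word_map f v x) => //.
by apply: (@piece_sub v); exists x.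
Qed.

Lemma cover_words n x : K x -> exists2 v, size v = n & piece f K v x.
Proof.
elim: n x => [|n IH] x Kx; first by exists [::] => //; exists x.
have [_ _ KE] := K_attractor; move: Kx; rewrite {1}KE => -[i _ [y Ky <-]].
have [v <- [z Kz <-]] := IH y Ky.
by exists (i :: v) => //; exists z.
Qed.

Lemma piece_extend w x n : piece f K w x ->
  exists2 t, size t = n & piece f K (w ++ t) x.
Proof.
move=> [y Ky <-]; have [t tn [z Kz <-]] := cover_words n Ky.
by exists t => //; exists z => //; rewrite word_map_cat.
Qed.

Lemma piece_nonempty w : piece f K w !=set0.
Proof. by have [[x Kx] _ _] := K_attractor; exists (word_map f w x), x. Qed.

Lemma diam_attractor_fin : exists D, diam K = D%:E.
Proof.
have [[x Kx] cK _] := K_attractor.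
have [D D0 KD] := compact_mdist_bound (ex_intro _ x Kx : K !=set0) cK.
have diam_ge0 : (0 <= diam K)%E.
  by apply: ereal_sup_ubound; exists x => //; exists x => //; rewrite mdistxx.
have diam_leD : (diam K <= D%:E)%E.
  by apply: ge_ereal_sup => _ [y Ky [z Kz <-]]; rewrite lee_fin KD.
exists (fine (diam K)).
by rewrite fineK// ge0_fin_numE// (le_lt_trans diam_leD) ?ltry.
Qed.

Variable D : R.
Hypothesis diamK : diam K = D%:E.

Lemma mdist_le_diamK x y : K x -> K y -> mdist x y <= D.
Proof.
by move=> Kx Ky; rewrite -lee_fin -diamK; apply: ereal_sup_ubound; exists x => //; exists y.
Qed.

Lemma diamK_ge0 : 0 <= D.
Proof.
have [[x Kx] _ _] := K_attractor.
exact: le_trans (mdist_ge0 x x) (mdist_le_diamK Kx Kx).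
Qed.

Lemma diam_piece w : diam (piece f K w) = (ratio w * D)%:E.
Proof.
rewrite EFinM -diamK /diam -ereal_sup_pZl ?ratio_gt0//; congr ereal_sup.
apply/seteqP; split=> [_ [_ [x Kx <-] [_ [y Ky <-] <-]]|_ [_ [x Kx [y Ky <-]] <-]].
  rewrite word_map_sim EFinM; exists (mdist x y)%:E => //.
  by exists x => //; exists y.
rewrite -EFinM -word_map_sim; exists (word_map f w x); first by exists x.
by exists (word_map f w y); first by exists y.
Qed.

Lemma diam_piece_powR w s :
  poweR (diam (piece f K w)) s = (\prod_(i <- w) (c i `^ s) * D `^ s)%:E.
Proof.
rewrite diam_piece poweR_EFin powRM ?diamK_ge0 ?(ltW (ratio_gt0 w))//; congr (_ * _)%:E.
elim: w => [|i w IH]; first by rewrite !big_nil powR1.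
rewrite !big_cons powRM ?IH ?(ltW (ratio_gt0 w))//.
by case/andP: (c01 i) => /ltW.
Qed.

Lemma ratio_small e : 0 < e ->
  exists n, forall w, size w = n -> ratio w * D < e.
Proof.
pose M := \big[Num.max/0]_i c i; have M01 : 0 <= M < 1.
  rewrite /M; apply/andP; split; first exact: bigmax_ge_id.
  by apply/bigmax_ltP; split=> // i _; case/andP: (c01 i).
move=> e0; have [n _ DMe] := geometric_lt D 0 M01 e0.
exists n => w wn; apply: le_lt_trans DMe; rewrite mulrC ler_wpM2l ?diamK_ge0// -{}wn.
elim: w => [|i w IH]; first by rewrite big_nil.
rewrite big_cons exprS ler_pM ?(ltW (ratio_gt0 w))//; last exact: le_bigmax.
by case/andP: (c01 i) => /ltW.
Qed.

(** Long extensions of [w] whose pieces still contain [x] have diameter below the radius of a ball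
    about [x] whose trace on [K] lies in [A]. *)
Lemma small_piece A w x : interior_in K A x -> piece f K w x ->
  exists t, piece f K (w ++ t) `<=` A.
Proof.
move=> intA wx; have Kx := piece_sub wx.
have /interior_inP-/(_ Kx)[V [oV Vx VA]] := intA.
have /nbhs_ballP[e /= e0 eV] := open_nbhs_nbhs (conj oV Vx).
have [n small] := ratio_small e0.
have [t tn wtx] := piece_extend n wx; exists t => y wty.
apply: VA; split; last exact: piece_sub wty.
apply: eV; rewrite ballEmdist /=; apply: le_lt_trans (small t tn).
have [x' Kx' <-] := wtx; have [y' Ky' <-] := wty.
rewrite word_map_sim big_cat /= -mulrA.
apply: le_trans (ler_piMl _ (ratio_le1 w)) _.
  by rewrite mulr_ge0 ?mdist_ge0 ?(ltW (ratio_gt0 t)).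
by rewrite ler_pM2l ?ratio_gt0// mdist_le_diamK.
Qed.

(** * Private points and the separation properties *)

Lemma interior_in_sub A : interior_in K A `<=` A.
Proof. exact: (@interior_subset (subspace K)). Qed.

Lemma interior_inS A B : A `<=` B -> interior_in K A `<=` interior_in K B.
Proof. exact: (@interiorS (subspace K)). Qed.

(** Membership of [x] in [piece f K w] is implied: some piece of that level contains [x], and it can
    only be that of [w]. *)
Definition private w x := K x /\
  forall v, size v = size w -> piece f K v x -> v = w.

(** The empty word, absent from the definition of irreducibility, costs nothing: it is the only word
    of its length, so every point of [K] is private to it. *)
Lemma irreducibleP : irreducible f K <-> forall w, private w !=set0.
Proof.
split=> [irr w|priv n n1 w cov].
  have [->|w0] := eqVneq w [::].
    have [[x Kx] _ _] := K_attractor.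
    by exists x; split=> // v /size0nil.
  have := irr (size w); rewrite lt0n size_eq0 => /(_ w0 (in_tuple w)) cov.
  apply: contrapT => npriv; apply: cov; apply/seteqP; split=> [x [v _]|x Kx].
    exact: piece_sub.
  apply: contrapT => nx; apply: npriv; exists x; split=> // v vw vx.
  apply: contrapT => nvw; apply: nx.
  move/eqP in vw; exists (Tuple vw) => //= vE; apply: nvw.
  by have := congr1 val vE.
have [x [Kx wx]] := priv w; move: Kx; rewrite -cov => -[v /= vw vx].
by apply: vw; apply/val_inj; apply: wx => //; rewrite !size_tuple.
Qed.

Lemma LSP1P : LSP1 f K <-> forall v w x, size v = size w ->
  interior_in K (piece f K v) x -> interior_in K (piece f K w) x -> v = w.
Proof.
split=> [lsp v w x vw vx wx|sep n n1 v w vw].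
  apply: contrapT => nvw; have [w0|w0] := eqVneq w [::].
    by apply: nvw; move: vw; rewrite w0 => /size0nil.
  have := lsp (size w); rewrite lt0n size_eq0 => /(_ w0).
  move/eqP: vw => sv /(_ (Tuple sv) (in_tuple w)) dis.
  have : set0 x by rewrite -dis // => /(congr1 val).
  by [].
apply/seteqP; split=> // x [vx wx]; apply: vw; apply/val_inj.
by apply: sep vx wx; rewrite !size_tuple.
Qed.

Lemma LSP2P : LSP2 f K <-> forall w, interior_in K (piece f K w) !=set0.
Proof.
split=> [lsp w|lsp n n1 w]; last exact: lsp.
have [->|w0] := eqVneq w [::]; last first.
  by apply: (lsp (size w) _ (in_tuple w)); rewrite lt0n size_eq0.
have [[x Kx] _ _] := K_attractor; exists x.
apply/(interior_inP _ Kx); exists setT; split=> //; first exact: openT.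
by move=> y [_ Ky]; exists y.
Qed.

(** The other pieces of the level are finitely many closed sets. The complement of their union is
    open, contains the private point and has its trace on [K] inside the piece of [w]. *)
Lemma irreducible_LSP2 : irreducible f K -> LSP2 f K.
Proof.
move=> /irreducibleP priv; apply/LSP2P => w.
have [x [Kx wx]] := priv w; exists x; apply/(interior_inP _ Kx).
pose S := [set v : (size w).-tuple 'I_k | tval v <> w].
exists (~` \bigcup_(v in S) piece f K v); split.
- apply/closed_openC/closed_bigcup => [|v _]; last exact: piece_closed.
  exact: finite_finset.
- by move=> [v vw vx]; apply: vw; apply: wx; rewrite ?size_tuple.
- move=> y [ny Ky]; have [v vw vy] := cover_words (size w) Ky.
  have [<-//|nvw] := eqVneq v w; case: ny; move/eqP in vw.
  by exists (Tuple vw) => //; apply/eqP.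
Qed.

(** If the interiors met, some A_(vt) would lie in A_w. A private point of vt then lies in some
    A_(wt') with t' as long as t, which forces wt' = vt and so w = v. *)
Lemma irreducible_LSP1 : irreducible f K -> LSP1 f K.
Proof.
move=> /irreducibleP priv; apply/LSP1P => v w x vw vx wx.
have [t vtw] := small_piece wx (interior_in_sub vx).
apply: contrapT => nvw.
have [y [Ky vty]] := priv (v ++ t).
have [u us uy] := cover_words (size (v ++ t)) Ky.
have wy : piece f K w y by apply: vtw; rewrite -(vty u).
have [t' t's wt'y] := piece_extend (size t) wy.
have /(_ _ wt'y) := vty (w ++ t').
rewrite !size_cat t's vw => /(_ erefl) /eqP.
by rewrite eqseq_cat // => /andP[/eqP wv _]; apply: nvw.
Qed.

(** Without a private point, A_w is covered by the other pieces of its level. By [finite_baire] the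
    interior of A_w then meets the interior of one of them, against LSP1. *)
Lemma LSP_irreducible : LSP f K -> irreducible f K.
Proof.
move=> [/LSP1P sep /LSP2P int]; apply/irreducibleP => w.
apply: contrapT => npriv; have [x wx] := int w.
have Kx : K x by apply: piece_sub (interior_in_sub wx).
have /(interior_inP _ Kx)[V [oV Vx VA]] := wx.
have [|||v vS [W [oW WV [y [Wy Ky]] Wv]]] := @finite_baire X _
    [seq v <- [seq tval t | t : (size w).-tuple 'I_k] | v != w]
    (piece f K) K V _ oV.
- by move=> v _; exact: piece_closed.
- by exists x.
- move=> y Vy Ky; apply: contrapT => nv; apply: npriv; exists y; split=> // v vw vy.
  apply: contrapT => /eqP nvw; apply: nv; exists v => //.
  rewrite mem_filter nvw /=; move/eqP in vw.
  by apply/mapP; exists (Tuple vw); rewrite ?mem_enum.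
move: vS; rewrite mem_filter => /andP[/eqP nvw /mapP[v' _ vE]]; apply: nvw.
apply: (sep _ _ y); first by rewrite vE size_tuple.
  by apply/(interior_inP _ Ky); exists W.
apply/(interior_inP _ Ky); exists V; split=> //; exact: WV.
Qed.

(** Let vt be an extension of v at least as long as w. The nonempty interior of A_(vt) lies both in
    that of A_w and in that of the piece of the prefix of vt of length |w|, so LSP1 identifies the
    two words. *)
Lemma LSP_prefix : (2 <= k)%N -> LSP f K ->
  forall v w, piece f K v `<=` piece f K w -> seq.prefix w v.
Proof.
move=> k2 [/LSP1P sep /LSP2P int] v w vw.
(* If [v] is too short, extend it by a letter other than that of [w] at
   position [size v]. *)
have [t wvt pre] : exists2 t, (size w <= size (v ++ t))%N &
    seq.prefix w (v ++ t) -> seq.prefix w v.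
  have [wv|] := leqP (size w) (size v).
    by exists [::]; rewrite cats0.
  rewrite -subn_gt0; case n: (size w - size v)%N => [//|n'] _.
  pose i0 : 'I_k := Ordinal (ltnW k2); pose i1 : 'I_k := Ordinal k2.
  pose j := if nth i0 w (size v) == i0 then i1 else i0.
  have wE : size w = (size v + n'.+1)%N by lia.
  exists (nseq n'.+1 j); first by rewrite size_cat size_nseq wE.
  rewrite prefixE take_oversize ?size_cat ?size_nseq ?wE// => /eqP vjw.
  have := congr1 (fun s => nth i0 s (size v)) vjw.
  rewrite nth_cat ltnn subnn /= /j => jE.
  by move: jE; case: eqP => [-> /(congr1 val)//|ni0 /esym].
apply: pre; have [x vtx] := int (v ++ t).
rewrite prefixE; apply/eqP; apply: (sep _ _ x).
- by rewrite size_takel.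
- apply: interior_inS vtx; rewrite -{1}(cat_take_drop (size w) (v ++ t)).
  exact: piece_catl.
- by apply: interior_inS vtx => y /piece_catl /vw.
Qed.

(** Overlapping interiors put some A_(vt) inside A_w, so w is a prefix of vt, and equal lengths give
    w = v. *)
Lemma prefix_LSP1 :
  (forall v w, piece f K v `<=` piece f K w -> seq.prefix w v) -> LSP1 f K.
Proof.
move=> pre; apply/LSP1P => v w x vw vx wx.
have [t /pre] := small_piece wx (interior_in_sub vx).
by rewrite prefixE take_size_cat // => /eqP.
Qed.

Lemma LSP_tiling : LSP f K -> tiling f K.
Proof.
move=> [lsp1 /LSP2P int] n n1; split=> [|w]; first exact: lsp1.
apply/seteqP; split=> x.
  move=> /(@closureS (subspace K) _ _ (@interior_in_sub (piece f K w))).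
  rewrite -(@closure_id (subspace K) _).1//; apply/closed_subspaceP.
  by exists (piece f K w) => //; apply: piece_closed.
(* Every relative neighbourhood [B] of a point of A_w contains some A_(wt), whose nonempty interior
   lies in the interior of A_w. *)
move=> wx B Bx; have [t wtB] := small_piece Bx wx.
have [y wty] := int (w ++ t); exists y; split.
  by apply: interior_inS wty; apply: piece_catl.
by apply: wtB; apply: interior_in_sub.
Qed.

(** An empty interior would have empty closure, but a piece is nonempty and equals that closure. *)
Lemma tiling_LSP : tiling f K -> LSP f K.
Proof.
move=> til; split=> n n1; first by move=> v w; apply: (til n n1).1.
move=> w; have [x] := piece_nonempty w; rewrite -[piece _ _ _]((til n n1).2 w).
move=> /(_ setT) []; first exact: (@filterT _ (nbhs (x : subspace K))).
by move=> y [wy _]; exists y.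
Qed.

(** * Level sums and the infima [Hn3] and [Hn4] *)

Lemma level_sum n s :
  (\sum_(w : n.-tuple 'I_k) poweR (diam (level f K w)) s)%E =
  ((\sum_i c i `^ s) ^+ n * D `^ s)%:E.
Proof.
under eq_bigr do rewrite /level diam_piece_powR.
rewrite sumEFin -mulr_suml; congr (_ * _)%:E.
have := @sum_prefix_tuples R 'I_k (fun i => c i `^ s) [::] n isT.
rewrite big_nil mul1r subn0 => <-.
by apply: eq_bigl => w; rewrite prefix0s.
Qed.

Lemma Hn3_ge0 n s : (0 <= Hn3 f K n s)%E.
Proof.
by apply/ereal_infP => _ [l _ <-]; apply: sume_ge0 => w _; exact: poweR_ge0.
Qed.

Lemma Hn4_ge0 n s : (0 <= Hn4 f K n s)%E.
Proof.
by apply/ereal_infP => _ [m [B [_ _ ->]]]; apply: sume_ge0 => i _; exact: poweR_ge0.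
Qed.

Lemma Hn3_nondecreasing s : nondecreasing_seq (fun n => Hn3 f K n s).
Proof.
move=> m n mn; apply: le_ereal_inf => _ [l /= nl <-]; exists l => //=.
exact: leq_trans mn nl.
Qed.

Lemma Hn4_nondecreasing s : nondecreasing_seq (fun n => Hn4 f K n s).
Proof.
move=> m n mn; apply: le_ereal_inf => _ [p [B [Bl KB ->]]]; exists p, B; split=> //.
by move=> i; have [l nl Bi] := Bl i; exists l => //; apply: leq_trans mn nl.
Qed.

Lemma Hn4_le_cover (C : seq (seq 'I_k)) n s :
  (forall w, w \in C -> (n <= size w)%N) ->
  (forall x, K x -> exists2 w, w \in C & piece f K w x) ->
  (Hn4 f K n s <= \sum_(w <- C) poweR (diam (piece f K w)) s)%E.
Proof.
move=> sC KC; apply: ereal_inf_lbound.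
exists (size C), (fun i => piece f K (nth [::] C i)); split.
- move=> i; exists (size (nth [::] C i)); first by rewrite sC ?mem_nth.
  by exists (in_tuple (nth [::] C i)).
- move=> x /KC[w wC wx]; have iw : (index w C < size C)%N by rewrite index_mem.
  by exists (Ordinal iw) => //=; rewrite nth_index.
- by rewrite (big_nth [::]) big_mkord.
Qed.

Lemma Hn4_le_Hn3 n s : (Hn4 f K n s <= Hn3 f K n s)%E.
Proof.
apply/ereal_infP => _ [l /= nl <-].
have := @Hn4_le_cover [seq tval t | t : l.-tuple 'I_k] n s.
rewrite big_image /=; apply.
  by move=> w /mapP[t _ ->]; rewrite size_tuple.
move=> x /(cover_words l)[v vl vx]; exists v => //; move/eqP in vl.
by apply/mapP; exists (Tuple vl); rewrite ?mem_enum.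
Qed.

(** * Critical exponents and the similarity dimension *)

Variable alpha : R.
Hypothesis alpha_dim : is_similarity_dim c alpha.

Lemma sum_powR_gt_dim s : alpha < s -> 0 <= \sum_i c i `^ s < 1.
Proof.
move=> als; have [_ al1] := alpha_dim.
rewrite sumr_ge0 => [|i _]; last exact: powR_ge0.
have lt i : c i `^ s < c i `^ alpha.
  have /andP[ci0 ci1] := c01 i.
  by rewrite /powR gt_eqF// ltr_expR ltr_nM2r// ln_lt0// ci0.
rewrite -al1 /=; apply: ltr_sum => //.
(* Strictness of the summed inequality requires an index; one exists because the nonempty set [K] is
   a union over the indices. *)
have [[x Kx] _ KE] := K_attractor; move: Kx; rewrite KE => -[i _ _].
by apply/hasP; exists i; rewrite ?mem_index_enum.
Qed.

(** Level sums form a geometric sequence of ratio below 1, so their infimum over deep levels is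
    zero. *)
Lemma Hn3_eq0 n s : alpha < s -> Hn3 f K n s = 0%E.
Proof.
move=> /sum_powR_gt_dim q01; apply/eqP; rewrite eq_le Hn3_ge0 andbT.
apply/lee_addgt0Pr => e e0; rewrite add0e.
have [m nm qe] := geometric_lt (D `^ s) n q01 e0.
apply: (@le_trans _ _ ((D `^ s * (\sum_i c i `^ s) ^+ m)%:E)); last by rewrite lee_fin ltW.
by apply: ereal_inf_lbound; exists m => //; rewrite level_sum mulrC.
Qed.

Lemma irreducible_Hn4_ge n s : irreducible f K -> s <= alpha ->
  ((D `^ s)%:E <= Hn4 f K n s)%E.
Proof.
move=> /irreducibleP priv sal; apply/ereal_infP => _ [m [B [Bl KB ->]]].
have {Bl} /choice[W BW] : forall i, exists w, B i = piece f K w.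
  by move=> i; have [l _ [w ->]] := Bl i; exists w.
under eq_bigr do rewrite BW diam_piece_powR.
rewrite sumEFin lee_fin -mulr_suml ler_peMl ?powR_ge0//.
apply: (@le_trans _ _ (\sum_(i < m) \prod_(j <- W i) (c j `^ alpha))); last first.
  apply: ler_sum => i _; apply: ler_prod => j _; rewrite powR_ge0 /=.
  by apply: ger_powR sal; case/andP: (c01 j) => -> /ltW.
(* All cover words are compared at the common length [N]: weights at exponent [alpha] are preserved
   by passing to extensions, and the total weight of level [N] is 1. *)
have [_ al1] := alpha_dim; pose N := (\max_(i < m) size (W i))%N.
have sumN w : (size w <= N)%N ->
    \sum_(v : N.-tuple 'I_k | seq.prefix w v) \prod_(j <- v) (c j `^ alpha) =
    \prod_(j <- w) (c j `^ alpha).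
  by move=> wN; rewrite sum_prefix_tuples// al1 expr1n mulr1.
have := sumN [::] isT; rewrite big_nil => sum1.
rewrite -[leLHS]sum1 [leRHS](_ : _ = \sum_(i < m) \sum_(v : N.-tuple 'I_k)
    if seq.prefix (W i) v then \prod_(j <- v) (c j `^ alpha) else 0); last first.
  apply: eq_bigr => i _; rewrite -sumN ?big_mkcond//.
  exact: (@leq_bigmax _ (fun i => size (W i))).
rewrite exchange_big /= (eq_bigl xpredT) => [|v]; last exact: prefix0s.
(* It remains to see that each [v] of length [N] extends some [W i]. A private point of [v] lies in
   some piece of [W i], hence in a piece of an extension of [W i] of length [N], which must be that
   of [v]. *)
apply: ler_sum => v _; have [x [Kx vx]] := priv v.
have [i _] := KB x Kx; rewrite BW => Wx.
have WN : (size (W i) <= N)%N by apply: (@leq_bigmax _ (fun i => size (W i))).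
have [t ts Wtx] := piece_extend (N - size (W i)) Wx.
have Wv : seq.prefix (W i) v.
  by rewrite -(vx _ _ Wtx) ?prefix_prefix// size_cat ts subnKC// size_tuple.
rewrite (bigD1 i)//= Wv lerDl sumr_ge0// => j _.
by case: ifP => // _; apply: prodr_ge0 => l _; exact: powR_ge0.
Qed.

(** If [D] were zero, [K] would be a single point, private to two different letters at once. *)
Lemma irreducible_diam_gt0 : (2 <= k)%N -> irreducible f K -> 0 < D.
Proof.
move=> k2 /irreducibleP priv; rewrite lt_neqAle diamK_ge0 andbT; apply/negP => /eqP D0.
pose i0 : 'I_k := Ordinal (ltnW k2); pose i1 : 'I_k := Ordinal k2.
have [x [Kx ix]] := priv [:: i0]; have [y [Ky iy]] := priv [:: i1].
have xy : x = y.
  apply: mdist_positivity; apply/eqP.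
  by rewrite eq_le mdist_ge0 andbT D0 mdist_le_diamK.
have [v v1 vx] := cover_words 1 Kx.
by move: (iy v v1); rewrite -xy => /(_ vx); rewrite (ix v v1 vx) => -[].
Qed.

Lemma reducible_H4_eq0 w s : (forall x, ~ private w x) ->
  (\sum_i c i `^ s) ^+ size w - \prod_(i <- w) (c i `^ s) < 1 ->
  H4 f K s = 0%E.
Proof.
(* Every point of [K] is private to the empty word, so [w] is nonempty; hence concatenating words of
   length |w| reaches arbitrary depth. *)
move=> npriv q1; have w0 : (0 < size w)%N.
  rewrite lt0n size_eq0; apply/eqP => w0; have [[x Kx] _ _] := K_attractor.
  by apply: (npriv x); split=> // v; rewrite w0 => /size0nil.
pose P : pred ((size w).-tuple 'I_k) := fun t => tval t != w.
pose C := [seq tval t | t <- enum P].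
pose p v := \prod_(i <- v) (c i `^ s).
have p_ge0 v : 0 <= p v by apply: prodr_ge0 => i _; exact: powR_ge0.
have pC : \sum_(v <- C) p v < 1.
  apply: le_lt_trans q1; rewrite /C big_map big_enum /=.
  have := @sum_prefix_tuples R 'I_k (fun i => c i `^ s) [::] (size w) isT.
  rewrite big_nil mul1r subn0 => <-; rewrite [in leRHS](bigD1 (in_tuple w)) ?prefix0s//=.
  rewrite addrAC subrr add0r; rewrite [leRHS](eq_bigl P)//.
  by move=> t; rewrite prefix0s.
(* [Cn n] lists the concatenations of [n] words from [C]: their pieces cover [K], and their total
   weight is the [n]-th power of that of [C]. *)
pose Cn := fix Cn n := if n is n'.+1 then [seq u ++ v | u <- C, v <- Cn n'] else [:: [::]].
have Cn_size n v : v \in Cn n -> (n <= size v)%N.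
  elim: n v => // n IH _ /allpairsP[[u v] /= [/mapP[t _ ->] /IH nv ->]].
  by rewrite size_cat size_tuple; lia.
have Cn_cover n x : K x -> exists2 v, v \in Cn n & piece f K v x.
  elim: n x => [|n IH] x Kx; first by exists [::]; [rewrite mem_head|exists x].
  have : ~ (forall v, size v = size w -> piece f K v x -> v = w).
    by move=> h; apply: (npriv x).
  move=> /existsNP[u /not_implyP[uw /not_implyP[[y Ky <-] /eqP nuw]]].
  have [v vC [z Kz <-]] := IH y Ky.
  exists (u ++ v); last by exists z => //; rewrite word_map_cat.
  apply: allpairs_f => //; move/eqP in uw.
  by apply/mapP; exists (Tuple uw); rewrite ?mem_enum.
have Cn_sum n : \sum_(v <- Cn n) p v = (\sum_(v <- C) p v) ^+ n.
  elim: n => [|n IH]; first by rewrite big_seq1 /p big_nil.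
  rewrite exprS -IH /= big_allpairs_dep big_distrl /=; apply: eq_bigr => u _.
  by rewrite big_distrr /=; apply: eq_bigr => v _; rewrite /p big_cat.
rewrite /H4 (_ : (fun n => _) = cst 0%E) ?lim_cst//; apply/funext => n /=.
apply/eqP; rewrite eq_le Hn4_ge0 andbT; apply/lee_addgt0Pr => e e0; rewrite add0e.
have q01 : 0 <= \sum_(v <- C) p v < 1 by rewrite sumr_ge0.
have [m nm qe] := geometric_lt (D `^ s) n q01 e0.
apply: le_trans (@Hn4_le_cover (Cn m) n s _ (Cn_cover m)) _.
  by move=> v /Cn_size; apply: leq_trans.
under eq_bigr do rewrite diam_piece_powR.
by rewrite sumEFin lee_fin -mulr_suml Cn_sum mulrC ltW.
Qed.

Lemma H4_dim_irreducible : (0 < H4 f K alpha)%E -> irreducible f K.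
Proof.
move=> H4_gt0; apply/irreducibleP => w; apply: contrapT => npriv.
move: H4_gt0; rewrite (@reducible_H4_eq0 w) ?ltxx// => [x wx|].
  by apply: npriv; exists x.
have [_ ->] := alpha_dim; rewrite expr1n ltrBlDr ltrDl.
by apply: prodr_gt0 => i _; apply: powR_gt0; case/andP: (c01 i).
Qed.

(** The quantity required to be below 1 in [reducible_H4_eq0] is continuous in the exponent, and at
    [alpha] it is 1 minus a positive weight. Without a private point, [H4] would thus vanish already
    at some positive exponent below [alpha]. *)
Lemma dim4_irreducible : dim4 f K = alpha%:E -> irreducible f K.
Proof.
move=> dimE; apply/irreducibleP => w; apply: contrapT => npriv.
have [al0 al1] := alpha_dim.
pose q s := (\sum_i c i `^ s) ^+ size w - \prod_(i <- w) (c i `^ s).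
have cq : q s @[s --> alpha] --> q alpha.
  have cpow i : powR (c i) s @[s --> alpha] --> powR (c i) alpha.
    by apply: continuous_powR; case/andP: (c01 i).
  have csum : \sum_i c i `^ s @[s --> alpha] --> \sum_i c i `^ alpha.
    by apply: cvg_big => [|i _ //]; exact: add_continuous.
  apply: cvgB; last by apply: cvg_big => [|i _ //]; exact: mul_continuous.
  apply: (@continuous_cvg _ _ _ _ _ _ (fun x : R => x ^+ size w)) csum.
  exact: exprn_continuous.
have q1 : q alpha < 1.
  rewrite /q al1 expr1n ltrBlDr ltrDl.
  by apply: prodr_gt0 => i _; apply: powR_gt0; case/andP: (c01 i).
have : \forall s \near alpha^'-, [/\ 0 < s, s < alpha & q s < 1].
  near=> s; split.
  - by near: s; exact: nbhs_left_gt.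
  - by near: s; exact: nbhs_left_lt.
  - by near: s; apply: (cvgr_lt _ (cvg_at_left_filter cq)).
move=> /filter_ex[s [s0 sal qs1]].
suff : (dim4 f K <= s%:E)%E by rewrite dimE lee_fin leNgt sal.
apply: ereal_inf_lbound; exists s => //; split; first exact: ltW.
by apply: reducible_H4_eq0 qs1 => x wx; apply: npriv; exists x.
Unshelve. all: by end_near.
Qed.

Lemma irreducible_H4_gt0 s : (2 <= k)%N -> irreducible f K -> s <= alpha ->
  (0 < H4 f K s)%E.
Proof.
move=> k2 irr sal; have D0 := irreducible_diam_gt0 k2 irr.
apply: lt_le_trans (nondecreasing_le_limn 0 (@Hn4_nondecreasing s)).
by apply: lt_le_trans (irreducible_Hn4_ge 0 irr sal); rewrite lte_fin powR_gt0.
Qed.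

(** Below [alpha], [H4] is positive and bounds [H3] from below; above [alpha], every [Hn3] vanishes
    and dominates [Hn4]. *)
Lemma irreducible_dim : (2 <= k)%N -> irreducible f K ->
  dim4 f K = alpha%:E /\ dim3 f K = alpha%:E.
Proof.
move=> k2 irr; have [/ltW al0 _] := alpha_dim.
have H4_gt0 s : 0 <= s < alpha -> (0 < H4 f K s)%E.
  by move=> /andP[_ /ltW]; exact: irreducible_H4_gt0.
split; apply: critical_exponentE => // s.
- by move=> /H4_gt0 /[swap] ->; rewrite ltxx.
- move=> als; rewrite /H4 (_ : (fun n => _) = cst 0%E) ?lim_cst//.
  apply/funext => n; apply/eqP.
  by rewrite eq_le Hn4_ge0 andbT -(Hn3_eq0 n als) Hn4_le_Hn3.
- move=> sal H30; have /H4_gt0 := sal; apply/negP; rewrite -leNgt -H30.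
  apply: lee_lim.
  + exact: ereal_nondecreasing_is_cvgn (@Hn4_nondecreasing s).
  + exact: ereal_nondecreasing_is_cvgn (@Hn3_nondecreasing s).
  + by apply: nearW => n; exact: Hn4_le_Hn3.
- move=> als; rewrite /H3 (_ : (fun n => _) = cst 0%E) ?lim_cst//.
  by apply/funext => n; exact: Hn3_eq0.
Qed.

End IteratedFunctionSystem.

Theorem theorem6p11 (R : realType) (X : completeMetricType R) (k : nat)
    (f : 'I_k -> X -> X) (c : 'I_k -> R) (K : set X) (alpha : R)
    (k_ge2 : (2 <= k)%N)
    (c_gt0_lt1 : forall i, 0 < c i < 1)
    (f_sim : forall i, similitude (f i) (c i))
    (K_attractor : is_attractor f K)
    (alpha_dim : is_similarity_dim c alpha) :
  [<-> irreducible f K;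
       dim4 f K = dim3 f K /\ dim3 f K = alpha%:E;
       LSP f K;
       LSP2 f K /\ (forall v w : seq 'I_k,
         piece f K v `<=` piece f K w -> seq.prefix w v);
       tiling f K;
       (0 < H4 f K alpha)%E].
Proof.
have [D KD] := diam_attractor_fin K_attractor.
have irr_LSP : irreducible f K -> LSP f K.
  move=> irr; split; last exact: (irreducible_LSP2 c_gt0_lt1 f_sim K_attractor).
  exact: (irreducible_LSP1 c_gt0_lt1 f_sim K_attractor KD irr).
(* The implications form a cycle in the listed order; those leaving the dimension equality and the
   tiling property pass through irreducibility. *)
tfae.
- move=> irr.
  by have [-> ->] := irreducible_dim c_gt0_lt1 f_sim K_attractor KD alpha_dim k_ge2 irr.
- move=> [<- dimE]; apply: irr_LSP.
  exact: (dim4_irreducible c_gt0_lt1 f_sim K_attractor KD alpha_dim dimE).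
- move=> lsp; split; first by case: lsp.
  by move=> v w; apply: (LSP_prefix K_attractor k_ge2 lsp).
- move=> [lsp2 pre]; apply: (LSP_tiling c_gt0_lt1 f_sim K_attractor KD); split=> //.
  exact: (prefix_LSP1 c_gt0_lt1 f_sim K_attractor KD pre).
- move=> /(tiling_LSP K_attractor)/(LSP_irreducible c_gt0_lt1 f_sim K_attractor) irr.
  exact: (irreducible_H4_gt0 c_gt0_lt1 f_sim K_attractor KD alpha_dim k_ge2 irr).
- exact: (H4_dim_irreducible c_gt0_lt1 f_sim K_attractor KD alpha_dim).
Qed.
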